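(* Assume the reduced operator $\widehat A_h\in\mathbb{R}^{n_h\times n_h}$ is square and invertible. For every $\ell_h\in\mathbb{R}^{N_h}$, $$\ell_h^\top(U_\theta-U_h^\star)=g_{\ell,h}^\top r_h .$$ Moreover, $$\sigma_{\ell,h}=\left(\widehat\ell_h^\top\widehat H_h^{-1}\widehat\ell_h\right)^{1/2}.$$ Consequently, $$|\ell_h^\top(U_\theta-U_h^\star)|\le\sigma_{\ell,h}\,\|r_h\|_{W_h}.$$
   Context: Let $U_{0,h}\in\mathbb{R}^{N_h}$ and let $Z_h\in\mathbb{R}^{N_h\times n_h}$ have full column rank; the admissible set is $\mathcal U_h=U_{0,h}+Z_h\mathbb{R}^{n_h}$. Let $A_h\in\mathbb{R}^{M_h\times N_h}$, $b_h\in\mathbb{R}^{M_h}$, and set $\widehat A_h:=A_hZ_h$, $\widehat b_h:=b_h-A_hU_{0,h}$. In the square setting $M_h=n_h$. Let $W_h\in\mathbb{R}^{M_h\times M_h}$ be symmetric positive definite, $\|r\|_{W_h}:=(r^\top W_hr)^{1/2}$, $\|g\|_{W_h^{-1}}:=(g^\top W_h^{-1}g)^{1/2}$, and $\widehat H_h:=\widehat A_h^\top W_h\widehat A_h$. The discrete target is $y_h^\star:=\widehat A_h^{-1}\widehat b_h$, $U_h^\star:=U_{0,h}+Z_hy_h^\star$. The vector $U_\theta=U_{0,h}+Z_hy_\theta$ (with $y_\theta\in\mathbb{R}^{n_h}$) is an arbitrary admissible vector, with residual $r_h:=A_hU_\theta-b_h=\widehat A_hy_\theta-\widehat b_h$.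 For $\ell_h\in\mathbb{R}^{N_h}$ put $\widehat\ell_h:=Z_h^\top\ell_h$, let $q_{\ell,h}\in\mathbb{R}^{n_h}$ solve $\widehat H_hq_{\ell,h}=\widehat\ell_h$, and define $g_{\ell,h}:=W_h\widehat A_hq_{\ell,h}\in\mathbb{R}^{M_h}$ and $\sigma_{\ell,h}:=\|g_{\ell,h}\|_{W_h^{-1}}$. *)

(* Defs.v *)
From mathcomp Require Import all_boot all_order all_algebra.
From mathcomp Require Import reals.

Set Implicit Arguments.
Unset Strict Implicit.
Unset Printing Implicit Defensive.

Import Order.TTheory GRing.Theory Num.Theory.
Local Open Scope ring_scope.

Section Definitions.
Variable R : realType.

Definition dotv (n : nat) (u v : 'cV[R]_n) : R := (u^T *m v) 0 0.

Definition sympd (m : nat) (W : 'M[R]_m) : Prop :=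
  W^T = W /\ forall x : 'cV[R]_m, x != 0 -> 0 < dotv x (W *m x).

Definition wnorm (m : nat) (W : 'M[R]_m) (x : 'cV[R]_m) : R :=
  Num.sqrt (dotv x (W *m x)).

Section Reduction.
Variables (M N n : nat).
Variables (U0 : 'cV[R]_N) (Z : 'M[R]_(N, n)).
Variables (A : 'M[R]_(M, N)) (b : 'cV[R]_M) (W : 'M[R]_M).

Definition lift_adm (y : 'cV[R]_n) : 'cV[R]_N := U0 + Z *m y.

Definition red_op : 'M[R]_(M, n) := A *m Z.

Definition red_rhs : 'cV[R]_M := b - A *m U0.

Definition red_gram : 'M[R]_n := red_op^T *m W *m red_op.

Definition red_goal (l : 'cV[R]_N) : 'cV[R]_n := Z^T *m l.

Definition residual (U : 'cV[R]_N) : 'cV[R]_M := A *m U - b.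

Definition goal_weight (q : 'cV[R]_n) : 'cV[R]_M := W *m red_op *m q.

(* [invmx W] is the genuine inverse as soon as [sympd W]: see [sympd_unit]. *)
Definition goal_sigma (q : 'cV[R]_n) : R := wnorm (invmx W) (goal_weight q).

End Reduction.

Definition target (N n : nat) (U0 : 'cV[R]_N) (Z : 'M[R]_(N, n))
    (A : 'M[R]_(n, N)) (b : 'cV[R]_n) : 'cV[R]_N :=
  lift_adm U0 Z (invmx (red_op Z A) *m red_rhs U0 A b).

Lemma sympd_unit (m : nat) (W : 'M[R]_m) : sympd W -> W \in unitmx.
Proof.
move=> [symW posW]; rewrite -row_free_unit -kermx_eq0; apply/eqP/row_matrixP => i.
rewrite row0; apply/eqP; apply: contraT => ki_neq0.
have kW : row i (kermx W) *m W = 0 by apply/sub_kermxP; exact: row_sub.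
have := posW (row i (kermx W))^T; rewrite trmx_eq0 => /(_ ki_neq0).
by rewrite /dotv trmxK mulmxA kW mul0mx mxE ltxx.
Qed.

(* In the square invertible setting the inverse of [red_gram] is genuine, and
   [red_gram Z A W *m q = red_goal Z l] has exactly one solution [q]. *)
Lemma red_gram_unit (N n : nat) (Z : 'M[R]_(N, n)) (A : 'M[R]_(n, N))
    (W : 'M[R]_n) :
  sympd W -> red_op Z A \in unitmx -> red_gram Z A W \in unitmx.
Proof.
move=> /sympd_unit uW uA.
by rewrite /red_gram !unitmx_mul unitmx_tr uA uW.
Qed.

End Definitions.

(* Main.v *)
Require Import Defs.
From mathcomp Require Import all_boot all_order all_algebra.
From mathcomp Require Import reals.
From mathcomp Require Import ring.
Import Order.TTheory GRing.Theory Num.Theory.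
Local Open Scope ring_scope.

(** The error [e = ytheta - ystar] satisfies [r = Ahat e], and [q] solves the
    adjoint equation, so [l^T Z e = (H q)^T e = (W Ahat q)^T r].  With
    [v = Ahat q], both [sigma^2] and [lhat^T H^-1 lhat] are the [W]-square
    [v^T W v], and the bound is Cauchy-Schwarz for the [W]-inner product. *)

Lemma dotvDl {R : realType} {n : nat} (u v w : 'cV[R]_n) :
  dotv (u + v) w = dotv u w + dotv v w.
Proof. by rewrite /dotv linearD mulmxDl mxE. Qed.

Lemma dotvZl {R : realType} {n : nat} (c : R) (u v : 'cV[R]_n) :
  dotv (c *: u) v = c * dotv u v.
Proof. by rewrite /dotv linearZ -scalemxAl mxE. Qed.

Lemma dotvC {R : realType} {n : nat} (u v : 'cV[R]_n) : dotv u v = dotv v u.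
Proof. by rewrite /dotv -[v in LHS]trmxK -trmx_mul mxE. Qed.

Lemma dotv_mulmx {R : realType} {m n : nat} (B : 'M[R]_(m, n))
    (u : 'cV[R]_m) (v : 'cV[R]_n) :
  dotv u (B *m v) = dotv (B^T *m u) v.
Proof. by rewrite /dotv trmx_mul trmxK mulmxA. Qed.

Lemma sympd_ge0 {R : realType} {n : nat} (W : 'M[R]_n) (x : 'cV[R]_n) :
  sympd W -> 0 <= dotv x (W *m x).
Proof.
move=> [_ posW]; have [->|/posW/ltW//] := eqVneq x 0.
by rewrite /dotv !mulmx0 mxE.
Qed.

(** Cauchy-Schwarz in squared form: the [W]-form is nonnegative at the part of [v] that is
    [W]-orthogonal to [u], scaled by [s] to avoid division. *)
Lemma sympd_sqr_dotv_le {R : realType} {n : nat} (W : 'M[R]_n)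
    (u v : 'cV[R]_n) :
  sympd W ->
  dotv u (W *m v) ^+ 2 <= dotv u (W *m u) * dotv v (W *m v).
Proof.
move=> sW; have [symW posW] := sW.
have [->|u_neq0] := eqVneq u 0; first by rewrite /dotv trmx0 !mul0mx mxE expr0n mul0r.
have s_gt0 := posW _ u_neq0.
set s := dotv u (W *m u) in s_gt0 *.
set t := dotv u (W *m v); set p := dotv v (W *m v).
have vuE : dotv v (W *m u) = t by rewrite dotv_mulmx symW dotvC.
have : 0 <= s * (s * p - t ^+ 2).
  suff <- : dotv (s *: v + - t *: u) (W *m (s *: v + - t *: u))
            = s * (s * p - t ^+ 2) by exact: sympd_ge0.
  (* Linearity is stated for the left argument only, so [dotvC] brings each argument there in
     turn. *)
  rewrite mulmxDr -!scalemxAr dotvC !(dotvDl, dotvZl).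
  rewrite !(dotvC (W *m _)) !(dotvDl, dotvZl) vuE -/s -/t -/p.
  by ring.
by rewrite pmulr_rge0// subr_ge0.
Qed.

Lemma sympd_cauchy_schwarz {R : realType} {n : nat} (W : 'M[R]_n)
    (u v : 'cV[R]_n) :
  sympd W -> `|dotv u (W *m v)| <= wnorm W u * wnorm W v.
Proof.
move=> sW; rewrite /wnorm -sqrtrM ?sympd_ge0// -sqrtr_sqr.
by rewrite ler_wsqrtr// sympd_sqr_dotv_le.
Qed.

(** Turns the dual norm of [g] into the [W]-norm of [Ahat q], since [invmx W] cancels [W]. *)
Lemma wnorm_invmx {R : realType} {n : nat} (W : 'M[R]_n) (v : 'cV[R]_n) :
  W \in unitmx -> wnorm (invmx W) (W *m v) = wnorm W v.
Proof. by move=> uW; rewrite /wnorm mulKmx// dotvC. Qed.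

(** The reduced target solves [Ahat y = bhat] exactly, so [bhat] can be replaced by [Ahat ystar]. *)
Lemma residual_lift {R : realType} {N n : nat} (U0 : 'cV[R]_N)
    (Z : 'M[R]_(N, n)) (A : 'M[R]_(n, N)) (b y : 'cV[R]_n) :
  red_op Z A \in unitmx ->
  residual A b (lift_adm U0 Z y)
  = red_op Z A *m (y - invmx (red_op Z A) *m red_rhs U0 A b).
Proof.
move=> uA; rewrite mulmxBr mulKVmx// /residual /lift_adm /red_rhs /red_op.
by rewrite mulmxDr mulmxA opprB addrCA addrA.
Qed.

Theorem proposition4p3 (R : realType) (N n : nat)
    (U0 : 'cV[R]_N) (Z : 'M[R]_(N, n)) (rankZ : \rank Z = n)
    (A : 'M[R]_(n, N)) (b : 'cV[R]_n)
    (W : 'M[R]_n) (sympdW : sympd W)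
    (invA : red_op Z A \in unitmx)
    (ytheta : 'cV[R]_n) (l : 'cV[R]_N)
    (q : 'cV[R]_n) (solq : red_gram Z A W *m q = red_goal Z l) :
  let Utheta := lift_adm U0 Z ytheta in
  let Ustar := target U0 Z A b in
  let r := residual A b Utheta in
  let g := goal_weight Z A W q in
  let sigma := goal_sigma Z A W q in
  [/\ dotv l (Utheta - Ustar) = dotv g r,
      sigma = Num.sqrt (dotv (red_goal Z l)
                             (invmx (red_gram Z A W) *m red_goal Z l))
    & `|dotv l (Utheta - Ustar)| <= sigma * wnorm W r].
Proof.
move=> Utheta Ustar r g sigma.
have uW := sympd_unit sympdW.
have goalE : red_goal Z l = (red_op Z A)^T *m g.
  by rewrite -solq /g /goal_weight /red_gram !mulmxA.
have gE : g = W *m (red_op Z A *m q) by rewrite mulmxA.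
have sigmaE : sigma = wnorm W (red_op Z A *m q).
  by rewrite /sigma /goal_sigma -/g gE wnorm_invmx.
have errE : dotv l (Utheta - Ustar) = dotv g r.
  (* Transposition moves [Ahat] onto [g], giving [Z^T l], then [Z] back onto the error; the offset
     [U0] cancels in the difference. *)
  rewrite /r residual_lift// dotv_mulmx -goalE /red_goal -dotv_mulmx.
  by rewrite /Utheta /Ustar /target /lift_adm opprD addrACA subrr add0r -mulmxBr.
split=> //.
(* [H^-1 lhat] is [q], and [lhat^T q = g^T (Ahat q)]. *)
- rewrite sigmaE -solq mulKmx; last exact: red_gram_unit.
  by rewrite solq goalE -dotv_mulmx gE dotvC.
(* Symmetry of [W] exhibits [g^T r] as the [W]-inner product of [Ahat q] and [r]. *)
- have grE : dotv g r = dotv (red_op Z A *m q) (W *m r).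
    by rewrite gE [RHS]dotv_mulmx (proj1 sympdW).
  by rewrite errE grE sigmaE sympd_cauchy_schwarz.
Qed.
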